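(* Let $\mathcal{E}$ be a finite-dimensional real Euclidean space, $\mathcal{K}\subseteq\mathcal{E}$ a closed convex cone, $\mathcal{L}\subseteq\mathcal{E}$ a linear subspace and $\mathbf{a}\in\mathcal{E}$ with $(\mathcal{L}+\mathbf{a})\cap\mathcal{K}\neq\emptyset$. Let $$\mathcal{F}_\ell\subsetneq\cdots\subsetneq\mathcal{F}_1=\mathcal{K}$$ be a chain of faces of $\mathcal{K}$ together with vectors $\mathbf{z}_i\in\mathcal{F}_i^*\cap\mathcal{L}^\perp\cap\{\mathbf{a}\}^\perp$ such that $\{\mathcal{F}_\ell,\mathcal{L}+\mathbf{a}\}$ satisfies the PPS condition and $\mathcal{F}_{i+1}=\mathcal{F}_i\cap\{\mathbf{z}_i\}^\perp$ for every $i=1,\dots,\ell-1$. For $i=1,\dots,\ell-1$, let $\psi_i$ be a one-step facial residual function for $\mathcal{F}_i$ and $\mathbf{z}_i$. Then there are positively rescaled shifts of the $\psi_i$ (still denoted $\psi_i$) such that for any bounded set $B\subseteq\mathcal{E}$ there is a positive constant $\kappa_B$ (depending on $B,\mathcal{L},\mathbf{a},\mathcal{F}_\ell$) such that, for all $\mathbf{x}$ and all $\epsilon\ge 0$, $$\mathbf{x}\in B,\quad \mathrm{d}(\mathbf{x},\mathcal{K})\le\epsilon,\quad \mathrm{d}(\mathbf{x},\mathcal{L}+\mathbf{a})\le\epsilon\quad\Rightarrow\quad \mathrm{d}\left(\mathbf{x},(\mathcal{L}+\mathbf{a})\cap\mathcal{K}\right)\le\kappa_B(\epsilon+\varphi(\epsilon,M)),$$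 where $M=\sup_{\mathbf{x}\in B}\|\mathbf{x}\|$ and $\varphi=\psi_{\ell-1}\diamondsuit\cdots\diamondsuit\psi_1$ if $\ell\ge 2$; if $\ell=1$, $\varphi$ is the function satisfying $\varphi(\epsilon,M)=\epsilon$.
   Context: $\mathrm{d}(\mathbf{x},C)=\inf_{\mathbf{y}\in C}\|\mathbf{x}-\mathbf{y}\|$; $\mathcal{K}^*=\{\mathbf{z}:\langle\mathbf{x},\mathbf{z}\rangle\ge0\ \forall\mathbf{x}\in\mathcal{K}\}$ is the dual cone; $\mathrm{ri}$ denotes relative interior; $\mathbb{R}_+=[0,\infty)$. A face of a closed convex cone $\mathcal{K}$ is a closed convex cone $\mathcal{F}\subseteq\mathcal{K}$ such that $\mathbf{x},\mathbf{y}\in\mathcal{K}$, $\mathbf{x}+\mathbf{y}\in\mathcal{F}$ imply $\mathbf{x},\mathbf{y}\in\mathcal{F}$. PPS (partial polyhedral Slater's) condition: for a closed convex cone $\mathcal{C}$ and an affine space $\mathcal{L}+\mathbf{a}$, the pair $\{\mathcal{C},\mathcal{L}+\mathbf{a}\}$ satisfies the PPS condition if one of the following holds: 1) $(\mathcal{L}+\mathbf{a})\cap\mathrm{ri}\,\mathcal{C}\ne\emptyset$; 2) $(\mathcal{L}+\mathbf{a})\cap\mathcal{C}\ne\emptyset$ and $\mathcal{C}$ is polyhedral; 3) $\mathcal{C}$ can be written as a direct product $\mathcal{C}^1\times\mathcal{C}^2\subseteq\mathcal{E}^1\times\mathcal{E}^2$ (with $\mathcal{E}^1,\mathcal{E}^2$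 real Euclidean spaces) where $\mathcal{C}^1$ is polyhedral and $(\mathcal{L}+\mathbf{a})\cap(\mathcal{C}^1\times\mathrm{ri}\,\mathcal{C}^2)\neq\emptyset$. One-step facial residual function: for a closed convex cone $\mathcal{C}$ and $\mathbf{z}\in\mathcal{C}^*$, a function $\psi:\mathbb{R}_+\times\mathbb{R}_+\to\mathbb{R}_+$ is a one-step facial residual function for $\mathcal{C}$ and $\mathbf{z}$ if $\psi$ is nonnegative, monotone nondecreasing in each argument, $\psi(0,t)=0$ for all $t\in\mathbb{R}_+$, and for every $\mathbf{x}\in\mathrm{span}\,\mathcal{C}$ and $\epsilon\ge0$: $\mathrm{d}(\mathbf{x},\mathcal{C})\le\epsilon$ and $\langle\mathbf{x},\mathbf{z}\rangle\le\epsilon$ imply $\mathrm{d}(\mathbf{x},\mathcal{C}\cap\{\mathbf{z}\}^\perp)\le\psi(\epsilon,\|\mathbf{x}\|)$. Positively rescaled shift: $\tilde\psi$ is a positively rescaled shift of $\psi$ if there are constants $M_1,M_2,M_3>0$ and $M_4\ge0$ with $\tilde\psi(\epsilon,t)=M_3\psi(M_1\epsilon,M_2t)+M_4\epsilon$. Diamond composition: for $f,g:\mathbb{R}_+\times\mathbb{R}_+\to\mathbb{R}_+$, $(f\diamondsuit g)(a,b)=f(a+g(a,b),b)$; and $f_m\diamondsuit\cdots\diamondsuit f_1:=f_m\diamondsuit(f_{m-1}\diamondsuit(\cdots\diamondsuit(f_2\diamondsuit f_1)))$ (for $m=1$ it is $f_1$). *)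

(* Defs.v *)
From HB Require Import structures.
From mathcomp Require Import all_boot all_order all_algebra.
From mathcomp Require Import all_classical all_reals all_analysis.

Set Implicit Arguments.
Unset Strict Implicit.
Unset Printing Implicit Defensive.

Import Order.TTheory GRing.Theory Num.Theory.
Import numFieldNormedType.Exports.

Local Open Scope classical_set_scope.
Local Open Scope ring_scope.

(* The norm and the topology are those of the normed module; [dotxx] says that
   this norm is the Euclidean one, whence [dot] is positive definite. *)
HB.mixin Record isEuclidean (R : realType) E
    & NormedModule R E & Vector R E := {
  dot : E -> E -> R ;
  dotC : forall x y : E, dot x y = dot y x ;
  dot_linearl : forall y : E, scalar (dot^~ y) ;
  dotxx : forall x : E, dot x x = `|x| ^+ 2 }.

#[short(type="euclideanType")]
HB.structure Definition Euclidean (R : realType) :=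
  {E of NormedModule R E & Vector R E & isEuclidean R E}.

Section cones.
Context {R : realType} {E : euclideanType R}.
Implicit Types (A B C F K : set E) (L : {vspace E}) (a x y z : E).

(* Only meaningful for [A !=set0]: the real [inf] of the empty set is 0. *)
Definition distance x A : R := inf [set `|x - y| | y in A].

Definition orthogonal_to A : set E := [set z | forall x, A x -> dot x z = 0].

Definition translate L a : set E := [set u + a | u in [set` L]].

Definition span_of A : set E :=
  [set x | exists2 s : seq E, (forall v, v \in s -> A v) & x \in span s].

Definition affine_set A :=
  forall (t : R) x y, A x -> A y -> A ((1 - t) *: x + t *: y).

Definition affine_hull A : set E := smallest affine_set A.

Definition relint A : set E :=
  [set x | A x /\ exists2 e : R, 0 < e & ball x e `&` affine_hull A `<=` A].

Definition polyhedral A :=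
  exists n (u : 'I_n -> E) (b : 'I_n -> R),
    A = [set x | forall i, dot (u i) x <= b i].

Definition closed_convex_cone C :=
  [/\ C !=set0,
      forall (t : R) x, 0 <= t -> C x -> C (t *: x),
      convex_set (C : set (convex_lmodType E)) &
      closed C].

Definition dual_cone C : set E := [set z | forall x, C x -> 0 <= dot x z].

Definition face F K :=
  [/\ closed_convex_cone F,
      F `<=` K &
      forall x y, K x -> K y -> F (x + y) -> F x /\ F y].

Definition sumset A B : set E := [set x + y | x in A & y in B].

(* In the third case the factors are taken inside [E]: [C1] and [C2] lie in
   independent subspaces [E1] and [E2], so that [sumset C1 C2] is the image of
   [C1 `*` C2] under the linear isomorphism [(x, y) |-> x + y] from the product
   of [E1] and [E2] onto [E1 + E2].  [E1] and [E2] need not be orthogonal, since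
   polyhedrality and relative interior do not depend on the inner product. *)
Definition PPS C L a :=
  [\/ translate L a `&` relint C !=set0,
      translate L a `&` C !=set0 /\ polyhedral C |
      exists (E1 E2 : {vspace E}) (C1 C2 : set E),
        [/\ directv (E1 + E2),
            C1 `<=` [set` E1] /\ C2 `<=` [set` E2],
            C = sumset C1 C2,
            polyhedral C1 &
            translate L a `&` sumset C1 (relint C2) !=set0]].

(* Functions of two nonnegative reals are represented by functions
   [R -> R -> R] of which only the values at nonnegative arguments matter. *)
Definition one_step_frf C z (psi : R -> R -> R) :=
  [/\ forall e t, 0 <= e -> 0 <= t -> 0 <= psi e t,
      forall e e' t, 0 <= e -> e <= e' -> 0 <= t -> psi e t <= psi e' t,
      forall e t t', 0 <= e -> 0 <= t -> t <= t' -> psi e t <= psi e t',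
      forall t, 0 <= t -> psi 0 t = 0 &
      forall x e, span_of C x -> 0 <= e ->
        distance x C <= e -> dot x z <= e ->
        distance x (C `&` orthogonal_to [set z]) <= psi e `|x|].

End cones.

Section residual_functions.
Context {R : realType}.

Definition rescaled_shift (psi' psi : R -> R -> R) :=
  exists M1 M2 M3 M4 : R,
    [/\ 0 < M1, 0 < M2, 0 < M3, 0 <= M4 &
        forall e t, 0 <= e -> 0 <= t ->
          psi' e t = M3 * psi (M1 * e) (M2 * t) + M4 * e].

Definition diamond (f g : R -> R -> R) : R -> R -> R :=
  fun a b => f (a + g a b) b.

(* [f m] <> ([f m.-1] <> ( ... <> [f 1])) for [1 <= m], where <> is [diamond];
   [(e, t) |-> e] for [m = 0]. *)
Fixpoint diamonds (f : nat -> R -> R -> R) (m : nat) : R -> R -> R :=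
  match m with
  | 0%N => fun e _ => e
  | 1%N => f 1%N
  | m'.+1 => diamond (f m) (diamonds f m')
  end.

End residual_functions.

(* Main.v *)
From HB Require Import structures.
Require Import Defs.
From mathcomp Require Import all_boot all_order all_algebra.
From mathcomp Require Import all_classical all_reals all_analysis.
From mathcomp Require Import ring lra.

Set Implicit Arguments.
Unset Strict Implicit.
Unset Printing Implicit Defensive.

Import Order.TTheory GRing.Theory Num.Theory.
Import numFieldNormedType.Exports.

Local Open Scope classical_set_scope.
Local Open Scope ring_scope.

(* The PPS condition makes the affine space and the last face boundedly linearly
   regular: on a bounded set the distance to the intersection is at most a
   constant times the sum of the two distances. Writing the face as a direct sum
   C1 + C2, one moves a given point of the affine space successively
   - into the affine hull of C2 (regularity of a pair of affine sets),
   - into the polyhedral set given by C1 (Hoffman's lemma),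
   - towards a point whose C2-component is relatively interior, which absorbs the
     remaining error in that component.
   The distance to the last face is controlled one face at a time: near a point x
   of B lies a point y of F_i with norm at most 2|x|, and z_i is orthogonal to
   the affine space, so <y, z_i> is bounded by the two distances and psi_i applies
   to y. *)

(** * Cauchy-Schwarz, linear forms as vectors, bounded linear maps *)

Section inner_product.
Context {R : realType} {E : euclideanType R}.
Implicit Types (x y z : E) (t : R).

Lemma dotDl x y z : dot (x + y) z = dot x z + dot y z.
Proof. by have := dot_linearl z 1 x y; rewrite scale1r mul1r. Qed.

Lemma dot0l z : dot 0 z = 0.
Proof. by apply: (@addrI _ (dot 0 z)); rewrite -dotDl !addr0. Qed.

Lemma dotZl t x z : dot (t *: x) z = t * dot x z.
Proof. by have := dot_linearl z t x 0; rewrite !addr0 dot0l addr0. Qed.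

Lemma dotNl x z : dot (- x) z = - dot x z.
Proof. by rewrite -scaleN1r dotZl mulN1r. Qed.

Lemma dotBl x y z : dot (x - y) z = dot x z - dot y z.
Proof. by rewrite dotDl dotNl. Qed.

Lemma dotZr t x z : dot x (t *: z) = t * dot x z.
Proof. by rewrite dotC dotZl dotC. Qed.

Lemma dotDr x y z : dot x (y + z) = dot x y + dot x z.
Proof. by rewrite dotC dotDl !(dotC x). Qed.

Lemma dotBr x y z : dot x (y - z) = dot x y - dot x z.
Proof. by rewrite dotC dotBl !(dotC x). Qed.

Lemma dot_suml I (s : seq I) (F : I -> E) z :
  dot (\sum_(i <- s) F i) z = \sum_(i <- s) dot (F i) z.
Proof.
by elim/big_ind2: _ => [|x a y b <- <-|//]; [exact: dot0l | exact: dotDl].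
Qed.

(** Expand the square of the norm of [|y| x - |x| y]: it is [2 |x| |y| (|x| |y| - dot x y)]. *)
Lemma cauchy_schwarz x y : dot x y <= `|x| * `|y|.
Proof.
have [->|x0] := eqVneq x 0; first by rewrite dot0l normr0 mul0r.
have [->|y0] := eqVneq y 0; first by rewrite dotC dot0l normr0 mulr0.
have nx : 0 < `|x| by rewrite normr_gt0.
have ny : 0 < `|y| by rewrite normr_gt0.
have h : 0 <= dot (`|y| *: x - `|x| *: y) (`|y| *: x - `|x| *: y).
  by rewrite dotxx sqr_ge0.
move: h; rewrite dotBl !dotBr !dotZl !dotZr !dotxx (dotC y x) => h.
have {}h : 0 <= 2 * (`|x| * `|y|) * (`|x| * `|y| - dot x y) by nra.
by rewrite -subr_ge0; rewrite pmulr_rge0 // in h; rewrite !mulr_gt0.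
Qed.

Lemma normr_dot x y : `|dot x y| <= `|x| * `|y|.
Proof.
rewrite ler_norml cauchy_schwarz andbT lerNl -mulN1r -dotZl scaleN1r.
by rewrite -(normrN x) cauchy_schwarz.
Qed.

Lemma dot_vbasis_eq0 x :
  (forall v, v \in vbasis (fullv : {vspace E}) -> dot x v = 0) -> x = 0.
Proof.
move=> x0; apply/eqP; rewrite -normr_eq0 -sqrf_eq0 -dotxx.
rewrite {2}(coord_vbasis (memvf x)) dotC dot_suml big1// => i _.
by rewrite dotZl dotC x0 ?mulr0// mem_nth// size_tuple.
Qed.

(** The frame operator of the family [s]. *)
Definition dot_family (s : seq E) x : E := \sum_(v <- s) dot x v *: v.

Lemma dot_family_linear s : linear (dot_family s).
Proof.
move=> t x y; rewrite /dot_family scaler_sumr -big_split /=.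
by apply: eq_bigr => i _; rewrite dotDl dotZl scalerDl scalerA.
Qed.

HB.instance Definition _ s :=
  GRing.isLinear.Build R E E *:%R (dot_family s) (dot_family_linear s).

(** The frame operator of a basis is injective, since a vector of its kernel is orthogonal to the
    basis. The representing vector is the preimage of [c]: comparing coordinates shows that it
    agrees with [f] on the basis. *)
Lemma riesz_representation (f : {scalar E}) : exists u, forall x, f x = dot x u.
Proof.
pose b := vbasis (fullv : {vspace E}).
have bfree : free b by exact: basis_free (vbasisP _).
have bK x : x = \sum_(i < _) coord b i x *: b`_i by apply/coord_vbasis/memvf.
have TE x : linfun (dot_family b) x = \sum_(i < \dim {:E}) dot x b`_i *: b`_i.
  rewrite lfunE /= /dot_family (big_nth 0) big_mkord.
  by rewrite size_tuple.
have T0 : lker (linfun (dot_family b)) == 0%VS.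
  rewrite -subv0; apply/subvP => x; rewrite memv_ker TE memv0 => /eqP x0.
  apply/eqP/dot_vbasis_eq0 => _ /(nthP 0)[i + <-]; rewrite size_tuple => id.
  have := coord_sum_free (fun j : 'I_(\dim {:E}) => dot x b`_j)
    (Ordinal id) bfree.
  by rewrite x0 linear0.
pose c := \sum_(i < \dim {:E}) f b`_i *: b`_i.
exists ((linfun (dot_family b))^-1%VF c) => x.
have ub (i : 'I_(\dim {:E})) :
    dot ((linfun (dot_family b))^-1%VF c) b`_i = f b`_i.
  have := lker0_lfunVK T0 c; rewrite TE => /(congr1 (coord b i)).
  by rewrite !coord_sum_free.
rewrite {1 2}(bK x) linear_sum dot_suml; apply: eq_bigr => i _.
by rewrite linearZ dotZl dotC ub.
Qed.

Lemma linear_bounded (f : 'End(E)) :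
  exists2 k : R, 0 <= k & forall x, `|f x| <= k * `|x|.
Proof.
pose b := vbasis (fullv : {vspace E}).
have bK x : x = \sum_(i < _) coord b i x *: b`_i by apply/coord_vbasis/memvf.
have /choice[u uE] i := riesz_representation (coord b i).
exists (\sum_(i < \dim {:E}) `|u i| * `|f b`_i|).
  by apply: sumr_ge0 => i _; rewrite mulr_ge0.
move=> x; rewrite {1}(bK x) linear_sum mulr_suml.
apply: le_trans (ler_norm_sum _ _ _) _; apply: ler_sum => i _.
by rewrite linearZ normrZ uE mulrAC ler_wpM2r// mulrC normr_dot.
Qed.

Definition dotr y x : R := dot x y.

HB.instance Definition _ y :=
  GRing.isLinear.Build R E R *%R (dotr y) (dot_linearl y).

(** Serves to pull a linear inequality on a projection of [x] back to one on [x]. *)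
Lemma adjoint_vector (f : 'End(E)) y :
  exists u, forall x, dot (f x) y = dot x u.
Proof. exact: (riesz_representation (dotr y \o f)). Qed.

End inner_product.

(** * Affine sets and regularity of pairs of them *)

Section affine_sets.
Context {R : realType} {E : euclideanType R}.
Implicit Types (A G H : set E) (x y p : E) (M k r t : R).

(* Turns an identity between linear combinations into one that [ring] solves. *)
Lemma dot_inj x y : (forall w, dot x w = dot y w) -> x = y.
Proof.
move=> h; apply/eqP; rewrite -subr_eq0 -normr_eq0 -sqrf_eq0 -dotxx.
by rewrite dotBl h subrr.
Qed.

(** The point is the midpoint of [(1 - 2t) p + 2t x] and [(1 + 2t) p - 2t y]. *)
Lemma affine_set_shift A t p x y :
  affine_set A -> A p -> A x -> A y -> A (p + t *: (x - y)).
Proof.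
move=> aA Ap Ax Ay.
have := aA 2^-1 _ _ (aA (2 * t) _ _ Ap Ax) (aA (- (2 * t)) _ _ Ap Ay).
congr A; apply: dot_inj => w.
by rewrite !(dotDl, dotNl, dotZl); field.
Qed.

(** Take a subspace [U] of maximal dimension inside [S]; adjoining to it any [x] in [S] stays inside
    [S], so [x] is already in [U]. *)
Lemma linear_closed_vspace (S : set E) :
  S 0 -> (forall t x y, S x -> S y -> S (t *: x + y)) ->
  exists U : {vspace E}, S = [set` U].
Proof.
move=> S0 SD.
pose P n := `[< exists2 U : {vspace E}, \dim U = n & [set` U] `<=` S >].
have P0 : exists n, P n.
  exists 0%N; apply/asboolP; exists 0%VS; first exact: dimv0.
  by move=> x /=; rewrite memv0 => /eqP ->.
have Pmax n : P n -> (n <= \dim {:E})%N.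
  by move=> /asboolP[U <- _]; exact/dimvS/subvf.
case: (ex_maxnP P0 Pmax) => n /asboolP[U Un US] nmax.
exists U; apply/seteqP; split => // x Sx /=.
have /nmax : P (\dim (<[x]> + U)).
  apply/asboolP; exists (<[x]> + U)%VS => // v /= /memv_addP[a].
  by move=> /vlineP[t ->] [c Uc ->]; apply: SD => //; exact: US.
rewrite -Un => le; have := dimv_leqif_sup (addvSr <[x]> U).
move=> [_]; rewrite eqn_leq le dimvS ?addvSr// => /esym.
by rewrite subv_add => /andP[].
Qed.

Lemma affine_set_vspace A p : affine_set A -> A p ->
  exists U : {vspace E}, forall x, A x <-> x - p \in U.
Proof.
move=> aA Ap; have [||U SU] := @linear_closed_vspace [set v | A (p + v)].
- by rewrite /= addr0.
- move=> t x y /= Ax Ay; have := affine_set_shift t aA Ay Ax Ap.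
  by rewrite [p + x]addrC addrK -addrA [y + _]addrC.
- exists U => x; have <- : [set v | A (p + v)] (x - p) = (x - p \in U).
    by rewrite SU.
  by rewrite /= addrC subrK.
Qed.

(** With directions [U] and [V], the difference [y - c] splits as [p1 + p2] in [U + V], and
    [y - p1 = c + p2] lies in both sets. As [p1] depends linearly on [y - c], a bound of that linear
    map gives [k]. *)
Lemma affine_set_regular A G p : affine_set A -> affine_set G -> A p -> G p ->
  exists2 k : R, 0 <= k & forall y c, A y -> G c ->
    exists w, [/\ A w, G w & `|y - w| <= k * `|y - c|].
Proof.
move=> aA aG Ap Gp.
have [U AU] := affine_set_vspace aA Ap; have [V GV] := affine_set_vspace aG Gp.
have [k k0 kP] := linear_bounded (addv_pi1 U V).
exists k => // y c /AU Ay /GV Gc.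
have yc : y - c \in (U + V)%VS.
  have -> : y - c = (y - p) + (p - c) by rewrite addrA subrK.
  by rewrite memv_add// -opprB memvN.
have e := addv_pi1_pi2 yc; have d1 := memv_pi1 U V (y - c).
have d2 := memv_pi2 U V (y - c).
set p1 := addv_pi1 U V (y - c) in e d1; set p2 := addv_pi2 _ _ _ in e d2.
exists (y - p1); split.
- by apply/AU; rewrite addrAC memvB.
- apply/GV; have -> : y - p1 - p = (c - p) + p2; last by rewrite memvD.
  apply: dot_inj => w; move/(congr1 (dot^~ w)): e.
  by rewrite !(dotDl, dotNl, dotZl); lra.
- by rewrite subKr; exact: kP.
Qed.

(** * Polyhedra and Hoffman's lemma on bounded sets *)

Lemma affine_set_hyperplane A (u : E) (b : R) : affine_set A ->
  affine_set (A `&` [set x | dot u x = b]).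
Proof.
move=> aA t x y [Ax /= ux] [Ay /= uy]; split; first exact: aA.
by rewrite /= dotDr !dotZr ux uy; ring.
Qed.

(** A list of constraints, so that Hoffman's lemma can go by induction on it. *)
Definition polyhedron (s : seq (E * R)) : set E :=
  [set x | forall c, c \in s -> dot c.1 x <= c.2].

Lemma polyhedron_convex s x y t : 0 <= t -> t <= 1 ->
  polyhedron s x -> polyhedron s y -> polyhedron s ((1 - t) *: x + t *: y).
Proof.
move=> t0 t1 Px Py c cs; rewrite dotDr !dotZr.
have := Px c cs; have := Py c cs; nra.
Qed.

Lemma seq_norm_bound (s : seq (E * R)) :
  exists2 N : R, 0 <= N & forall c, c \in s -> `|c.1| <= N.
Proof.
elim: s => [|c s [N N0 NP]]; first by exists 0.
exists (`|c.1| + N) => [|d]; first exact: addr_ge0.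
rewrite inE => /predU1P[->|/NP dN]; first by rewrite lerDl.
by rewrite (le_trans dN)// lerDr.
Qed.

(** If [dot u] is not constant on [A], sliding along a fixed direction of [A] on which it does not
    vanish corrects its value; if it is constant, [y] is already on the hyperplane. *)
Lemma hyperplane_regular A (u : E) (b : R) : affine_set A ->
  (A `&` [set x | dot u x = b]) !=set0 ->
  exists2 k : R, 0 <= k & forall y, A y ->
    exists w, [/\ A w, dot u w = b & `|y - w| <= k * `|dot u y - b|].
Proof.
move=> aA [p [Ap /= up]].
have [[v1 [v2 [Av1 Av2 v12]]]|/forallNP cst] :=
  pselect (exists v1 v2, [/\ A v1, A v2 & dot u (v1 - v2) != 0]).
  exists (`|v1 - v2| / `|dot u (v1 - v2)|); first by rewrite divr_ge0.
  move=> y Ay; exists (y + ((b - dot u y) / dot u (v1 - v2)) *: (v1 - v2)).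
  split; first exact: affine_set_shift.
    by rewrite dotDr dotZr divfK// addrC subrK.
  rewrite opprD addrA subrr add0r normrN normrZ normrM normfV distrC.
  by rewrite mulrC mulrCA mulrC -mulrA.
exists 0 => // y Ay; exists y; split=> //; last by rewrite subrr normr0 mul0r.
have := cst y => /forallNP/(_ p); have [h|h] := eqVneq (dot u (y - p)) 0.
  by move: h; rewrite dotBr up => /eqP; rewrite subr_eq0 => /eqP.
by move=> /not_and3P[].
Qed.

(* When the new inequality [dot u x <= b]
   cannot be satisfied strictly, it is an equation on the feasible set, and the
   induction continues in the hyperplane where it holds. *)
Lemma hoffman_bounded s A : affine_set A -> A `&` polyhedron s !=set0 ->
  forall M, exists2 k : R, 0 <= k & forall x r, A x -> `|x| <= M ->
    0 <= r -> r <= M -> (forall c, c \in s -> dot c.1 x <= c.2 + r) ->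
    exists w, [/\ A w, polyhedron s w & `|x - w| <= k * r].
Proof.
elim: s A => [|[u b] s IH] A aA [p [Ap Pp]] M.
  by exists 0 => // x r Ax _ _ _ _; exists x; rewrite subrr normr0 mul0r.
have Psp : polyhedron s p by move=> c cs; apply: Pp; rewrite inE cs orbT.
have up : dot u p <= b by apply: (Pp (u, b)); rewrite mem_head.
have [k k0 kP] := IH A aA (ex_intro _ p (conj Ap Psp)) M.
pose C := 1 + `|u| * k.
have C0 : 0 <= C by rewrite addr_ge0// mulr_ge0.
(* The induction hypothesis repairs the constraints of [s]; the move has length at most [k * r], so
   the constraint [(u, b)] is then violated by at most [C * r]. *)
have first_step x r : A x -> `|x| <= M -> 0 <= r -> r <= M ->
    (forall c, c \in (u, b) :: s -> dot c.1 x <= c.2 + r) ->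
    exists y, [/\ A y, polyhedron s y, `|x - y| <= k * r,
      `|y| <= M + k * M & dot u y <= b + C * r].
  move=> Ax xM r0 rM h.
  have [|y [Ay Py xy]] := kP x r Ax xM r0 rM.
    by move=> c cs; apply: h; rewrite inE cs orbT.
  exists y; split => //.
    have -> : y = x - (x - y) by rewrite subKr.
    apply: le_trans (ler_normB _ _) _; apply: lerD => //.
    by apply: le_trans xy _; exact: ler_wpM2l.
  have := h (u, b); rewrite mem_head => /(_ isT) /= ux.
  have : dot u (y - x) <= `|u| * (k * r).
    by apply: le_trans (cauchy_schwarz _ _) _; rewrite ler_wpM2l// distrC.
  by rewrite dotBr /C; lra.
have [[q [Aq Pq uq]]|noq] :=
  pselect (exists q, [/\ A q, polyhedron s q & dot u q < b]).
  pose e := b - dot u q; have e0 : 0 < e by rewrite subr_gt0.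
  pose D := M + k * M + `|q|.
  exists (k + C / e * `|D|).
    by rewrite addr_ge0// mulr_ge0// divr_ge0// ltW.
  move=> x r Ax xM r0 rM h.
  have [y [Ay Py xy yM uy]] := first_step x r Ax xM r0 rM h.
  have Cr : 0 <= C * r by rewrite mulr_ge0.
  have den : 0 < C * r + e by rewrite ltr_wpDl.
  (* With this [t], the excess [C * r] at [y] and the slack [e] at [q] cancel:
     [(1 - t) (C * r) = t * e]. *)
  pose t := C * r / (C * r + e).
  have tden : t * (C * r + e) = C * r by rewrite divfK// gt_eqF.
  have t0 : 0 <= t by rewrite divr_ge0// ltW.
  have t1 : t <= 1 by rewrite ler_pdivrMr// mul1r lerDl ltW.
  have te : t <= C * r / e.
    by rewrite /t ler_wpM2l// lef_pV2 ?posrE// lerDr.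
  exists ((1 - t) *: y + t *: q); split; first exact: aA.
    move=> c; rewrite inE => /predU1P[-> /=|cs].
      rewrite dotDr !dotZr; rewrite /e in tden; nra.
    exact: (polyhedron_convex t0 t1 Py Pq).
  have -> : x - ((1 - t) *: y + t *: q) = (x - y) + t *: (y - q).
    by apply: dot_inj => w; rewrite !(dotDl, dotNl, dotZl); ring.
  apply: le_trans (ler_normD _ _) _; rewrite mulrDl; apply: lerD => //.
  have -> : C / e * `|D| * r = C * r / e * `|D| by ring.
  rewrite normrZ ger0_norm// ler_pM// (le_trans (ler_normB _ _))//.
  by apply: le_trans (ler_norm _); rewrite /D lerD2r.
have {}noq q : A q -> polyhedron s q -> b <= dot u q.
  by move=> Aq Pq; rewrite leNgt; apply/negP => ?; apply: noq; exists q.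
have upb : dot u p = b by apply/eqP; rewrite eq_le up noq.
have Hp : (A `&` [set x | dot u x = b]) p by [].
have [k1 k10 k1P] := hyperplane_regular aA (ex_intro _ p Hp).
have [N N0 NP] := seq_norm_bound s.
pose C1 := k1 * C.
have C10 : 0 <= C1 by rewrite mulr_ge0.
(* The radius has to bound both the norm of the point [y'] found on the hyperplane and its error
   [N * (C1 * r)] in the constraints of [s]. *)
have [k2 k20 k2P] := IH _ (affine_set_hyperplane aA)
  (ex_intro _ p (conj Hp Psp))
  (M + k * M + C1 * `|M| + N * C1 * `|M|).
exists (k + C1 + k2 * (N * C1)).
  by rewrite !addr_ge0// !mulr_ge0.
move=> x r Ax xM r0 rM h.
have [y [Ay Py xy yM uy]] := first_step x r Ax xM r0 rM h.
have M0 : 0 <= M by exact: le_trans rM.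
have [y' [Ay' uy' yy']] := k1P y Ay.
(* By [noq], [dot u y] is at least [b], so its distance to [b] is at most [C * r]. *)
have {}yy' : `|y - y'| <= C1 * r.
  apply: le_trans yy' _; rewrite /C1 -mulrA ler_wpM2l//.
  by rewrite ger0_norm ?subr_ge0 ?noq// lerBlDl.
have C1r : C1 * r <= C1 * `|M| by rewrite ler_wpM2l// ger0_norm.
have [||||w [[Aw uw] Pw y'w]] := k2P y' (N * (C1 * r)) (conj Ay' uy').
- have -> : y' = y - (y - y') by rewrite subKr.
  apply: le_trans (ler_normB _ _) _.
  have : 0 <= N * C1 * `|M| by rewrite !mulr_ge0.
  lra.
- by rewrite !mulr_ge0.
- have : N * (C1 * r) <= N * C1 * `|M| by rewrite -mulrA ler_wpM2l.
  have : 0 <= k * M by rewrite mulr_ge0.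
  have : 0 <= C1 * `|M| by rewrite mulr_ge0.
  lra.
- move=> c cs; have := Py c cs.
  have : dot c.1 (y' - y) <= N * (C1 * r).
    apply: le_trans (cauchy_schwarz _ _) _.
    by rewrite ler_pM ?NP// distrC.
  rewrite dotBr; lra.
exists w; split => //.
  move=> c; rewrite inE => /predU1P[-> /=|cs]; last exact: Pw.
  by rewrite uw.
have -> : x - w = (x - y) + (y - y') + (y' - w) by rewrite !subrKA.
have -> : (k + C1 + k2 * (N * C1)) * r = k * r + C1 * r + k2 * (N * (C1 * r)).
  by ring.
rewrite (le_trans (ler_normD _ _))// lerD//.
by rewrite (le_trans (ler_normD _ _))// lerD.
Qed.

End affine_sets.

(** * Distances, and bounded linear regularity from the PPS condition *)

Section bounded_regularity.
Context {R : realType} {E : euclideanType R}.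
Implicit Types (A B C G H : set E) (L : {vspace E}) (a x y p q : E).
Implicit Types (M k r t : R).

Lemma distance_le A x y : A y -> distance x A <= `|x - y|.
Proof.
by move=> Ay; apply: ge_inf; [exists 0 => _ [z _ <-] | exists y].
Qed.

Lemma distance_ge0 A x : 0 <= distance x A.
Proof.
have [A0|/set0P/negP/negPn/eqP ->] := pselect (A !=set0).
  apply: lb_le_inf => [|_ [z _ <-]//]; case: A0 => z Az.
  by exists `|x - z|, z.
by rewrite /distance image_set0 inf0.
Qed.

Lemma distance_adherent A x (e : R) : A !=set0 -> 0 < e ->
  exists2 y, A y & `|x - y| < distance x A + e.
Proof.
move=> [z Az] e0; have [|_ [y Ay <-] xy] := @inf_adherent R
  [set `|x - y| | y in A] _ e0; last by exists y.
by split; [exists `|x - z|, z | exists 0 => _ [y _ <-]].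
Qed.

Lemma distance_lipschitz A x y : A !=set0 ->
  distance x A <= `|x - y| + distance y A.
Proof.
move=> A0; apply/ler_addgt0Pr => e e0.
have [z Az yz] := distance_adherent y A0 e0.
apply: le_trans (distance_le _ Az) _.
rewrite -addrA (le_trans (ler_distD y _ _))// lerD2l ltW//.
Qed.

Lemma translate_affine L a : affine_set (translate L a).
Proof.
move=> t _ _ [u Lu <-] [v Lv <-]; exists ((1 - t) *: u + t *: v).
  by rewrite /= memvD// memvZ.
by apply: dot_inj => w; rewrite !(dotDl, dotNl, dotZl); ring.
Qed.

Lemma affine_hull_affine A : affine_set (affine_hull A).
Proof.
move=> t x y Ax Ay G AG; have [aG _] := AG.
by apply: aG; [exact: Ax | exact: Ay].
Qed.

Lemma polyhedral_polyhedron (s : seq (E * R)) : polyhedral (polyhedron s).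
Proof.
exists (size s), (fun i => (nth (0, 0) s i).1), (fun i => (nth (0, 0) s i).2).
apply/seteqP; split => x Px.
  by move=> i; apply: Px; exact: mem_nth.
by move=> c /(nthP (0, 0))[i si <-]; exact: (Px (Ordinal si)).
Qed.

(** Two opposite inequalities for each basis vector cut out the origin, which is the trivial summand
    in [PPS_sumset]. *)
Lemma polyhedral_set0 : polyhedral [set (0 : E)].
Proof.
pose b := vbasis (fullv : {vspace E}).
suff -> : [set (0 : E)] =
    polyhedron ([seq (v, 0) | v <- b] ++ [seq (- v, 0) | v <- b]).
  exact: polyhedral_polyhedron.
apply/seteqP; split => x.
  move=> -> c; rewrite mem_cat => /orP[]/mapP[v _ ->] /=;
  by rewrite dotC dot0l.
move=> Px; apply: dot_vbasis_eq0 => v bv; apply: le_anti; apply/andP; split.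
  by rewrite dotC; apply: (Px (v, 0)); rewrite mem_cat map_f.
have := Px (- v, 0); rewrite mem_cat (map_f (fun w => (- w, 0)) bv) orbT.
by move=> /(_ isT); rewrite dotNl oppr_le0 dotC.
Qed.

Lemma convex_cone_segment C t x y : closed_convex_cone C ->
  0 <= t -> t <= 1 -> C x -> C y -> C ((1 - t) *: x + t *: y).
Proof.
move=> [_ _ cC _] t0 t1 Cx Cy; rewrite addrC; apply/set_mem.
exact: (cC y x (Itv01 t0 t1)) (mem_set Cy) (mem_set Cx).
Qed.

Lemma relint_sub C : relint C `<=` C.
Proof. by move=> x []. Qed.

(** * Regularity for a direct sum with a polyhedral summand *)

Section direct_product.
Variables (E1 E2 : {vspace E}) (C1 C2 : set E).
Hypotheses (E12 : directv (E1 + E2))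
  (CE1 : C1 `<=` [set` E1]) (CE2 : C2 `<=` [set` E2]).

Let p1 := daddv_pi E1 E2.
Let p2 := daddv_pi E2 E1.

Lemma daddv_pi_sum u v : u \in E1 -> v \in E2 ->
  p1 (u + v) = u /\ p2 (u + v) = v.
Proof.
move=> u1 v2; have d := elimT directv_addP E12.
have e : p1 (u + v) + p2 (u + v) = u + v.
  by apply: daddv_pi_add => //; exact: memv_add.
have /= := elimT directv_add_unique E12 _ _ _ _ (memv_pi E1 E2 (u + v)) u1
  (memv_pi E2 E1 (u + v)) v2.
by rewrite e eqxx => /esym/eqP[].
Qed.

(** Stated for subsets of [C1] and [C2] so as to cover both [C2] and [relint C2]. *)
Lemma sumset_daddv D1 D2 x : D1 `<=` C1 -> D2 `<=` C2 ->
  sumset D1 D2 x <-> [/\ x \in (E1 + E2)%VS, D1 (p1 x) & D2 (p2 x)].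
Proof.
move=> DC1 DC2; split.
  move=> [u Du] [v Dv] <-.
  have u1 := CE1 (DC1 _ Du); have v2 := CE2 (DC2 _ Dv).
  by have [-> ->] := daddv_pi_sum u1 v2; split=> //; exact: memv_add.
move=> [x12 D1x D2x]; exists (p1 x) => //; exists (p2 x) => //.
exact: daddv_pi_add (elimT directv_addP E12) x12.
Qed.

Lemma sumset_bounded_regular A : affine_set A ->
  closed_convex_cone (sumset C1 C2) -> polyhedral C1 ->
  A `&` sumset C1 (relint C2) !=set0 ->
  forall M, exists2 k : R, 0 <= k & forall y c, A y -> sumset C1 C2 c ->
    `|y| <= M -> `|c| <= M ->
    exists w, [/\ A w, sumset C1 C2 w & `|y - w| <= k * `|y - c|].
Proof.
move=> aA cC [n [u [b C1E]]] [q [Aq]].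
rewrite (sumset_daddv _ (@subset_refl _ C1) (@relint_sub C2)).
move=> [q12 C1q [C2q [e e0 ball_e]]] M.
have CP x := sumset_daddv x (@subset_refl _ C1) (@subset_refl _ C2).
(* An affine relaxation of the cone: [C1] is dropped and [C2] is replaced by its affine hull. *)
pose G := [set x | x \in (E1 + E2)%VS /\ affine_hull C2 (p2 x)].
have aG : affine_set G.
  move=> t x y [x12 Gx] [y12 Gy]; split; first by rewrite memvD// memvZ.
  by rewrite linearD !linearZ; exact: affine_hull_affine.
have CG : sumset C1 C2 `<=` G.
  by move=> x /CP[x12 _ C2x]; split => //; exact: sub_gen_smallest.
have Gq : G q by split => //; exact: sub_gen_smallest.
(* Convexity is given for the sum only; adding the fixed point [p1 q] of [C1] transfers it to
   [C2]. *)
have C2_convex t x y : 0 <= t -> t <= 1 -> C2 x -> C2 y ->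
    C2 ((1 - t) *: x + t *: y).
  move=> t0 t1 C2x C2y.
  have C2C v : C2 v -> sumset C1 C2 (p1 q + v) by exists (p1 q) => //; exists v.
  have /CP[_ _] := convex_cone_segment cC t0 t1 (C2C _ C2x) (C2C _ C2y).
  have -> : (1 - t) *: (p1 q + x) + t *: (p1 q + y) =
      p1 q + ((1 - t) *: x + t *: y).
    by apply: dot_inj => w; rewrite !(dotDl, dotNl, dotZl); ring.
  have xy2 : (1 - t) *: x + t *: y \in E2.
    by rewrite memvD// memvZ//; exact: CE2.
  by have [_ ->] := daddv_pi_sum (CE1 C1q) xy2.
have /choice[u' u'E] i := adjoint_vector p1 (u i).
pose s := [seq (u' i, b i) | i <- enum 'I_n].
have sP x : polyhedron s x <-> C1 (p1 x).
  rewrite C1E; split => [Px i|Px _ /mapP[i _ ->]] /=.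
    by rewrite dotC u'E dotC; apply: (Px (u' i, b i)); rewrite map_f ?mem_enum.
  by rewrite dotC -u'E dotC; exact: Px.
have [ka ka0 kaP] := affine_set_regular aA aG Aq Gq.
have [N N0 NP] := seq_norm_bound s.
have [k2' k20 k2P'] := linear_bounded p2.
(* Adding 1 makes [k2] positive, hence also [k3] and [rho], by which [z] is scaled below. *)
pose k2 := k2' + 1.
have k2_gt0 : 0 < k2 by rewrite ltr_wpDl.
have {k2P'}k2P x : `|p2 x| <= k2 * `|x|.
  by rewrite (le_trans (k2P' x))// ler_wpM2r// lerDl.
(* The point [c] satisfies the constraints [s] and [y1] is within [(1 + ka) * d] of it, so [y1]
   violates them by at most [N1 * d]. *)
pose N1 := N * (1 + ka).
have N10 : 0 <= N1 by rewrite mulr_ge0// addr_ge0.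
have aAG : affine_set (A `&` G).
  by move=> t x y [Ax Gx] [Ay Gy]; split; [exact: aA|exact: aG].
pose D := `|M| + `|M|.
have D0 : 0 <= D by rewrite addr_ge0.
have qs : ((A `&` G) `&` polyhedron s) q by split => //; exact/sP.
have [kh kh0 khP] := hoffman_bounded aAG (ex_intro _ q qs)
  (`|M| + ka * D + N1 * D).
pose K := ka + kh * N1.
have K0 : 0 <= K by rewrite addr_ge0// mulr_ge0.
pose k3 := k2 * (K + 1).
have k30 : 0 < k3 by rewrite mulr_gt0// ltr_wpDl.
exists (K + 2 * k3 / e * (`|M| + K * D + `|q|)).
  rewrite addr_ge0// mulr_ge0//; last by rewrite !addr_ge0// mulr_ge0.
  by rewrite ltW// divr_gt0// mulr_gt0.
move=> y c Ay Cc yM cM.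
(* The case [d = 0] is set apart, since [rho] would vanish. *)
have [yc|yc] := eqVneq y c.
  rewrite yc in Ay *.
  by exists c; rewrite subrr normr0 mulr0.
set d := `|y - c|; have d0 : 0 < d by rewrite normr_gt0 subr_eq0.
have {}yM : `|y| <= `|M| by rewrite (le_trans yM)// ler_norm.
have {}cM : `|c| <= `|M| by rewrite (le_trans cM)// ler_norm.
have dD : d <= D by rewrite (le_trans (ler_normB _ _))// lerD.
have [y1 [Ay1 Gy1 yy1]] := kaP y c Ay (CG _ Cc).
rewrite -/d in yy1.
have y1c : `|y1 - c| <= (1 + ka) * d.
  rewrite (le_trans (ler_distD y _ _))// mulrDl mul1r addrC lerD//.
  by rewrite distrC.
have /CP[c12 C1c C2c] := Cc.
have [||||w1 [[Aw1 Gw1] Pw1 y1w1]] := khP y1 (N1 * d) (conj Ay1 Gy1).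
- have -> : y1 = y - (y - y1) by rewrite subKr.
  rewrite (le_trans (ler_normB _ _))//.
  have : ka * d <= ka * D by rewrite ler_wpM2l.
  have : 0 <= N1 * D by rewrite mulr_ge0.
  lra.
- by rewrite mulr_ge0// ltW.
- have : N1 * d <= N1 * D by rewrite ler_wpM2l.
  have : 0 <= ka * D by rewrite mulr_ge0.
  have := normr_ge0 M; lra.
- move=> v vs; have := (sP c).2 C1c v vs.
  have : dot v.1 (y1 - c) <= N1 * d.
    rewrite (le_trans (cauchy_schwarz _ _))// /N1 -mulrA.
    by rewrite ler_pM// NP.
  rewrite dotBr; lra.
have yw1 : `|y - w1| <= K * d.
  rewrite (le_trans (ler_distD y1 _ _))// /K mulrDl lerD//.
  by rewrite -mulrA.
have w1c : `|w1 - c| <= (K + 1) * d.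
  rewrite (le_trans (ler_distD y _ _))// mulrDl mul1r lerD//.
  by rewrite distrC.
(* [t] is such that [(1 - t) (p2 w1 - p2 c)] has norm less than [t e], so that
   [z] below is in the ball of radius [e] around [p2 q]. *)
pose rho := k3 * d; have rho0 : 0 < rho by rewrite mulr_gt0.
have gc : `|p2 w1 - p2 c| <= rho.
  rewrite -linearB (le_trans (k2P _))// /rho /k3 -mulrA ler_wpM2l//.
  exact: ltW.
have den : 0 < 2 * rho + e by rewrite addr_gt0// mulr_gt0.
pose t := 2 * rho / (2 * rho + e).
have tden : t * (2 * rho + e) = 2 * rho by rewrite divfK// gt_eqF.
have t0 : 0 < t by rewrite divr_gt0// mulr_gt0.
have t1 : t <= 1 by rewrite ler_pdivrMr// mul1r lerDl ltW.
have te : t <= 2 * rho / e.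
  have rho2 : 0 <= 2 * rho by rewrite mulr_ge0// ltW.
  by rewrite /t ler_wpM2l// lef_pV2 ?posrE// lerDr.
have w1M : `|w1| <= `|M| + K * D.
  have -> : w1 = y - (y - w1) by rewrite subKr.
  rewrite (le_trans (ler_normB _ _))// lerD// (le_trans yw1)//.
  by rewrite ler_wpM2l.
exists ((1 - t) *: w1 + t *: q); split; first exact: aA.
  apply/CP; split; first by rewrite memvD// memvZ//; case: Gw1.
    apply/sP/polyhedron_convex => //; [exact: ltW | exact/sP].
  have -> : p2 ((1 - t) *: w1 + t *: q) = (1 - t) *: p2 w1 + t *: p2 q.
    by rewrite linearD; congr (_ + _); exact: linearZ.
  pose z := p2 q + (e / (2 * rho)) *: (p2 w1 - p2 c).
  (* Since [t * (e / (2 * rho)) = 1 - t], the error [p2 w1 - p2 c] can be charged to [p2 q]: the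
     component in [E2] becomes a convex combination of [p2 c] and [z], both in [C2]. *)
  have -> : (1 - t) *: p2 w1 + t *: p2 q = (1 - t) *: p2 c + t *: z.
    have h : t * (e / (2 * rho)) = 1 - t.
      rewrite /t; field; rewrite ?gt_eqF//.
    by apply: dot_inj => w; rewrite /z scalerDr scalerA h
      !(dotDl, dotNl, dotZl); ring.
  apply: C2_convex => //; first exact: ltW.
  apply: ball_e; split.
    rewrite -ball_normE /= opprD addrA subrr add0r normrN normrZ.
    have er0 : 0 <= e / (2 * rho) by rewrite ltW// divr_gt0// mulr_gt0.
    rewrite ger0_norm//.
    have : e / (2 * rho) * `|p2 w1 - p2 c| <= e / (2 * rho) * rho.
      exact: ler_wpM2l.
    move=> /le_lt_trans; apply.
    have -> : e / (2 * rho) * rho = e / 2 by field; rewrite gt_eqF.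
    by rewrite ltr_pdivrMr// mulr_natr mulr2n ltrDl.
  apply: (affine_set_shift _ (@affine_hull_affine C2)).
  - exact: sub_gen_smallest.
  - by case: Gw1.
  - exact: sub_gen_smallest.
have -> : y - ((1 - t) *: w1 + t *: q) = (y - w1) + t *: (w1 - q).
  by apply: dot_inj => w; rewrite !(dotDl, dotNl, dotZl); ring.
rewrite (le_trans (ler_normD _ _))// [in leRHS]mulrDl lerD//.
have -> : 2 * k3 / e * (`|M| + K * D + `|q|) * d =
  2 * rho / e * (`|M| + K * D + `|q|) by rewrite /rho; ring.
rewrite normrZ gtr0_norm// ler_pM// ?(ltW t0)//.
by rewrite (le_trans (ler_normB _ _))// lerD2r.
Qed.

End direct_product.

(** The first two cases are instances of the third with a trivial summand: [C] is [{0} + C] in the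
    first and [C + {0}] in the second, [{0}] being its own relative interior. *)
Lemma PPS_sumset C L a : PPS C L a ->
  exists (E1 E2 : {vspace E}) (C1 C2 : set E),
    [/\ directv (E1 + E2), C1 `<=` [set` E1] /\ C2 `<=` [set` E2],
        C = sumset C1 C2, polyhedral C1 &
        translate L a `&` sumset C1 (relint C2) !=set0].
Proof.
case=> [[q [Lq rq]]|[[q [Lq Cq]] pC]|//].
  exists 0%VS, fullv, [set 0], C; split.
  - by apply/directv_addP; rewrite cap0v.
  - by split => x /=; [move=> ->; rewrite mem0v | rewrite memvf].
  - apply/seteqP; split => [x Cx|_ [_ -> [x Cx <-]]]; last by rewrite add0r.
    by exists 0 => //; exists x => //; rewrite add0r.
  - exact: polyhedral_set0.
  - by exists q; split => //; exists 0 => //; exists q => //; rewrite add0r.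
exists fullv, 0%VS, C, [set 0]; split => //.
- by apply/directv_addP; rewrite capv0.
- by split => x /=; [rewrite memvf | move=> ->; rewrite mem0v].
- apply/seteqP; split => [x Cx|_ [x Cx [_ -> <-]]]; last by rewrite addr0.
  by exists x => //; exists 0 => //; rewrite addr0.
- exists q; split => //; exists q => //; exists 0; last by rewrite addr0.
  split => //; exists 1 => // x [_]; rewrite /affine_hull smallest_id//.
  by move=> t _ _ -> ->; rewrite /= !scaler0 addr0.
Qed.

Lemma sumset_sub A A' B B' : A `<=` A' -> B `<=` B' ->
  sumset A B `<=` sumset A' B'.
Proof.
move=> AA' BB' _ [x Ax [y By <-]].
by exists x; [exact: AA' | exists y; first exact: BB'].
Qed.

Lemma PPS_meet C L a : PPS C L a -> translate L a `&` C !=set0.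
Proof.
move=> /PPS_sumset[E1 [E2 [C1 [C2 [_ _ -> _ [q [Lq Cq]]]]]]].
by exists q; split => //; exact: sumset_sub (@relint_sub C2) _ Cq.
Qed.

Lemma PPS_bounded_regular C L a B : closed_convex_cone C -> PPS C L a ->
  bounded_set B -> exists k : R, 0 < k /\ forall x, B x ->
    distance x (translate L a `&` C) <=
      k * (distance x (translate L a) + distance x C).
Proof.
move=> cC CLa [N [_ BN]].
have BM x : B x -> `|x| <= N + 1 by apply: BN; rewrite ltrDl.
have [p [Lp Cp]] := PPS_meet CLa.
have [E1 [E2 [C1 [C2 [E12 [CE1 CE2] CE pC1 CL]]]]] := PPS_sumset CLa.
(* Bounds the norm of a point whose distance to [x] is at most [|x - p| + 1]. *)
pose M := N + 1 + (N + 1 + `|p| + 1).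
rewrite {}CE in cC Cp *.
have [k k0 kP] := sumset_bounded_regular E12 CE1 CE2 (@translate_affine L a)
  cC pC1 CL M.
exists (1 + k); split; first by rewrite ltr_wpDr.
move=> x Bx; apply/ler_addgt0Pr => e e0.
(* The infima are approached up to [h], which costs [(1 + 2 * k) * h] in the final estimate. *)
pose h := Num.min 1 (e / (1 + 2 * k)).
have k2 : 0 < 1 + 2 * k by rewrite ltr_wpDr// mulr_ge0.
have h0 : 0 < h by rewrite lt_min ltr01 divr_gt0.
have h1 : h <= 1 by rewrite ge_min lexx.
have he : (1 + 2 * k) * h <= e.
  by rewrite mulrC -ler_pdivlMr// ge_min lexx orbT.
have close A : A p ->
    exists2 y, A y & `|y| <= M /\ `|x - y| <= distance x A + h.
  move=> Ap; have [y Ay xy] := distance_adherent x (ex_intro _ p Ap) h0.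
  exists y => //; split; last exact: ltW.
  have -> : y = x - (x - y) by rewrite subKr.
  rewrite (le_trans (ler_normB _ _))// lerD ?BM//.
  rewrite (le_trans (ltW xy))// lerD// (le_trans (distance_le _ Ap))//.
  by rewrite (le_trans (ler_normB _ _))// lerD2r BM.
have [y Ly [yM xy]] := close _ Lp.
have [c Cc [cM xc]] := close _ Cp.
have [w [Lw Cw yw]] := kP y c Ly Cc yM cM.
rewrite (le_trans (distance_le _ (conj Lw Cw)))//.
rewrite (le_trans (ler_distD y _ _))//.
have yc : `|y - c| <= `|x - y| + `|x - c|.
  by rewrite (le_trans (ler_distD x _ _))// lerD// distrC.
have := distance_ge0 C x; have := distance_ge0 (sumset C1 C2) x.
have : k * `|y - c| <= k * (`|x - y| + `|x - c|) by rewrite ler_wpM2l.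
nra.
Qed.

End bounded_regularity.

(** * One step of facial reduction, and the main result *)

Section facial_reduction.
Context {R : realType} {E : euclideanType R}.
Implicit Types (B C : set E) (L : {vspace E}) (a x y z : E) (d e g r : R).

Lemma closed_convex_cone0 C : closed_convex_cone C -> C 0.
Proof.
by move=> [[x Cx] Cs _ _]; rewrite -(scale0r x); exact: Cs.
Qed.

Lemma closed_distance0 C x : closed C -> C !=set0 -> distance x C <= 0 -> C x.
Proof.
move=> cC C0 xC; apply: cC => V /nbhs_ballP[e /= e0 eV].
have [y Cy xy] := distance_adherent x C0 e0.
exists y; split => //; apply: eV; rewrite -ball_normE /=.
by rewrite (lt_le_trans xy)// gerDr.
Qed.

(** The origin serves if [|x| <= 2 * d], and [x] itself if [d = 0], by closedness. Otherwise a point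
    of [C] within [2 * d < |x|] of [x] has norm at most [2 * |x|]. *)
Lemma cone_near_point C x d : closed_convex_cone C -> 0 <= d ->
  distance x C <= d ->
  exists2 y, C y & `|x - y| <= 2 * d /\ `|y| <= 2 * `|x|.
Proof.
move=> cC d0 xC; have C0 := closed_convex_cone0 cC.
have [xd|dx] := leP `|x| (2 * d).
  by exists 0 => //; rewrite subr0 normr0 mulr_ge0.
move: d0; rewrite le_eqVlt => /predU1P[d0|d0].
  exists x; last by rewrite subrr normr0 -d0 mulr0 ler_peMl ?ler1n.
  have [C1 _ _ clC] := cC.
  by apply: closed_distance0 => //; rewrite d0.
have [y Cy xy] := distance_adherent x (ex_intro _ 0 C0) d0.
have {}xy : `|x - y| <= 2 * d by lra.
exists y => //; split => //.
have -> : y = x - (x - y) by rewrite subKr.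
rewrite (le_trans (ler_normB _ _))// mulr_natl mulr2n lerD//.
by rewrite (le_trans xy)// ltW.
Qed.

(** The factor [4 * (|z| + 1)] covers the bound on [dot y z] at the nearby point [y] of the face,
    the factor 2 its norm, and the term [2 * e] its distance to [x]. *)
Definition facial_shift z (psi : R -> R -> R) : R -> R -> R :=
  fun e t => psi (4 * (`|z| + 1) * e) (2 * t) + 2 * e.

Lemma facial_shift_rescaled z psi : rescaled_shift (facial_shift z psi) psi.
Proof.
exists (4 * (`|z| + 1)), 2, 1, 2; split => // e t _ _.
by rewrite mul1r.
Qed.

(** As [z] is orthogonal to the affine space, [x] may be replaced by its difference with any point
    there. Taking [|z| + 1] for [|z|] allows division when [z = 0]. *)
Lemma dot_translate_le L a z x e : orthogonal_to [set` L] z ->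
  orthogonal_to [set a] z -> distance x (translate L a) <= e ->
  dot x z <= (`|z| + 1) * e.
Proof.
move=> zL za xe; have z1 : 0 < `|z| + 1 by rewrite ltr_wpDl.
apply/ler_addgt0Pr => h h0.
have h1 : 0 < h / (`|z| + 1) by rewrite divr_gt0.
have La0 : translate L a !=set0 by exists (0 + a), 0 => //=; exact: mem0v.
have [_ [v Lv <-] xv] := distance_adherent x La0 h1.
have -> : dot x z = dot (x - (v + a)) z.
  by rewrite !(dotDl, dotNl) (zL v Lv) (za a erefl) addr0 oppr0 addr0.
rewrite (le_trans (cauchy_schwarz _ _))//.
have : `|x - (v + a)| <= e + h / (`|z| + 1) by lra.
move=> /(ler_wpM2l (ltW z1)); rewrite mulrDr [_ * (h / _)]mulrC divfK ?gt_eqF//.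
apply: le_trans; rewrite mulrC ler_wpM2r// lerDl//.
Qed.

(** The hypotheses on [g] fit both uses: [g = e = d] at the first face and [g = e + d] at the later
    ones. *)
Lemma facial_step C z psi L a x d e g r : closed_convex_cone C ->
  one_step_frf C z psi -> orthogonal_to [set` L] z -> orthogonal_to [set a] z ->
  0 <= e -> 0 <= d -> d <= g -> e + d <= 2 * g ->
  distance x (translate L a) <= e -> distance x C <= d -> `|x| <= r ->
  distance x (C `&` orthogonal_to [set z]) <= facial_shift z psi g r.
Proof.
move=> cC [_ psi1 psi2 _ psiP] zL za e0 d0 dg edg xL xC xr.
have [y Cy [xy yx]] := cone_near_point cC d0 xC.
have g0 : 0 <= g by exact: le_trans dg.
have z1 : 0 <= `|z| + 1 by rewrite addr_ge0.
have Cz0 : (C `&` orthogonal_to [set z]) 0.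
  split; first exact: closed_convex_cone0.
  by move=> _ ->; rewrite dotC dot0l.
rewrite (le_trans (distance_lipschitz x y (ex_intro _ 0 Cz0)))//.
rewrite /facial_shift addrC lerD//; last by rewrite (le_trans xy)// ler_wpM2l.
pose h := 4 * (`|z| + 1) * g.
have h0 : 0 <= h by rewrite !mulr_ge0.
apply: (@le_trans _ _ (psi h `|y|)); last first.
  by apply: psi2 => //; rewrite (le_trans yx)// ler_wpM2l.
apply: psiP => //.
- exists [:: y]; first by move=> v; rewrite inE => /eqP ->.
  exact: memv_span1.
- by rewrite (le_trans (distance_le _ Cy))// subrr normr0.
- have xz := dot_translate_le zL za xL.
  have : dot (y - x) z <= (`|z| + 1) * (2 * d).
    rewrite (le_trans (cauchy_schwarz _ _))// distrC mulrC ler_pM// lerDl//.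
  rewrite dotBl /h.
  have : (`|z| + 1) * (e + d) <= (`|z| + 1) * (2 * g) by rewrite ler_wpM2l.
  have : (`|z| + 1) * d <= (`|z| + 1) * g by rewrite ler_wpM2l.
  nra.
Qed.

End facial_reduction.

(* [kappa B L a (F l)] is the constant: it depends on nothing else. *)
Theorem theorem3p8 (R : realType) (E : euclideanType R) :
  exists kappa : set E -> {vspace E} -> E -> set E -> R,
  forall (K : set E) (L : {vspace E}) (a : E)
         (l : nat) (F : nat -> set E) (z : nat -> E) (psi : nat -> R -> R -> R),
    closed_convex_cone K ->
    translate L a `&` K !=set0 ->
    (1 <= l)%N ->
    F 1%N = K ->
    (forall i, (1 <= i <= l)%N -> face (F i) K) ->
    (forall i, (1 <= i < l)%N -> F i.+1 `<` F i) ->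
    (forall i, (1 <= i < l)%N ->
      [/\ dual_cone (F i) (z i),
          orthogonal_to [set` L] (z i) &
          orthogonal_to [set a] (z i)]) ->
    PPS (F l) L a ->
    (forall i, (1 <= i < l)%N -> F i.+1 = F i `&` orthogonal_to [set z i]) ->
    (forall i, (1 <= i < l)%N -> one_step_frf (F i) (z i) (psi i)) ->
    exists psi' : nat -> R -> R -> R,
      (forall i, (1 <= i < l)%N -> rescaled_shift (psi' i) (psi i)) /\
      forall B : set E, bounded_set B ->
        0 < kappa B L a (F l) /\
        forall (x : E) (e : R), 0 <= e -> B x ->
          distance x K <= e -> distance x (translate L a) <= e ->
          distance x (translate L a `&` K) <=
            kappa B L a (F l) *
              (e + diamonds psi' l.-1 e (sup [set `|y| | y in B])).
Proof.
(* Choosing the regularity constant for each quadruple makes it a function of [B], [L], [a] and the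
   last face; where the hypotheses fail, its value is 1. *)
have /choice[kappa kappaP] (q : set E * {vspace E} * E * set E) : exists k : R,
    0 < k /\ (closed_convex_cone q.2 -> PPS q.2 q.1.1.2 q.1.2 ->
      bounded_set q.1.1.1 -> forall x, q.1.1.1 x ->
      distance x (translate q.1.1.2 q.1.2 `&` q.2) <=
        k * (distance x (translate q.1.1.2 q.1.2) + distance x q.2)).
  have [[cC CLa bB]|nh] := pselect [/\ closed_convex_cone q.2,
      PPS q.2 q.1.1.2 q.1.2 & bounded_set q.1.1.1].
    by have [k [k0 kP]] := PPS_bounded_regular cC CLa bB; exists k; split.
  by exists 1; split => // cC CLa bB; exfalso; apply: nh.
exists (fun B L a C => kappa (B, L, a, C)).
move=> K L a l F z psi cK LK l1 F1 Fface _ zP FPPS FS psiP.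
exists (fun i => facial_shift (z i) (psi i)); split.
  by move=> i _; exact: facial_shift_rescaled.
move=> B bB; have [k0 /= kP] := kappaP (B, L, a, F l).
split => // x e e0 Bx xK xL.
have [cFl FlK _] : face (F l) K by apply: Fface; rewrite l1 leqnn.
set M := sup _; have xM : `|x| <= M.
  apply: ub_le_sup; last by exists x.
  have [N [_ BN]] := bB; exists (N + 1) => _ [y By <-].
  by apply: BN => //; rewrite ltrDl.
have M0 : 0 <= M by exact: le_trans xM.
set psi' := fun i => _.
(* Faces are numbered from 1, so [m] compositions reach [F m.+1]; for [m = 0] the value [e] of
   [diamonds] bounds the distance to [K]. *)
have key m : (m < l)%N -> 0 <= diamonds psi' m e M /\
    distance x (F m.+1) <= diamonds psi' m e M.
  elim: m => [|m IH] ml; first by rewrite F1.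
  have [d0 xd] := IH (ltnW ml).
  have il : (1 <= m.+1 < l)%N by rewrite ltnS.
  have [_ zL za] := zP _ il.
  have [cF _ _] : face (F m.+1) K by apply: Fface; exact: ltnW ml.
  have psi0 : forall e t, 0 <= e -> 0 <= t -> 0 <= psi' m.+1 e t.
    move=> e' t e'0 t0; have [psi_ge0 _ _ _ _] := psiP _ il.
    rewrite /psi' /facial_shift addr_ge0 ?psi_ge0 ?mulr_ge0//.
  have step := facial_step cF (psiP _ il) zL za e0 d0.
  rewrite FS//; clear IH ml.
  (* [diamonds psi' 1] is [psi' 1] itself, evaluated at [e]; from the second step on the argument is
     [e + D]. *)
  case: m => [|m] in il d0 xd cF zL za psi0 step *.
    split; first exact: psi0.
    by apply: step => //; rewrite mulr_natl mulr2n.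
  rewrite [diamonds _ _.+2]/=; set D := diamonds psi' m.+1 in d0 xd step *.
  split; first by rewrite /diamond psi0// addr_ge0.
  apply: step => //; first by rewrite lerDr.
  by rewrite mulr_natl mulr2n lerDl addr_ge0.
have [|_ xd] := key l.-1; first by rewrite prednK.
rewrite prednK// in xd.
apply: (@le_trans _ _ (distance x (translate L a `&` F l))).
  apply/ler_addgt0Pr => h h0.
  have [y [Ly Fy] xy] := distance_adherent x (PPS_meet FPPS) h0.
  by rewrite (le_trans _ (ltW xy))// distance_le//; split => //; exact: FlK.
by rewrite (le_trans (kP cFl FPPS bB x Bx))// ler_wpM2l ?(ltW k0)// lerD.
Qed.
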